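(* If an online minimization problem $S$ is solved by a $c$-competitive (in expectation) randomized online algorithm $A$ using $s$ bits of memory, then there is a $c$-competitive (in expectation) quantum online algorithm $Q$ that solves $S$ using at most $s$ bits of classical memory and one qubit.
   Context: An online minimization problem has inputs $I=(x_1,\dots,x_n)$, outputs $(y_1,\dots,y_n)$ and a positive cost function; an online algorithm produces $y_i$ from $x_1,\dots,x_i$ only. A randomized online algorithm additionally reads a tape of independent uniformly random bits; it is $c$-competitive in expectation if there is $\alpha\ge 0$ with $\mathbb{E}[cost]\le c\cdot cost(Opt(I))+\alpha$ for every input $I$, $Opt$ an optimal offline algorithm. A quantum online algorithm may have classical and quantum memory, applies quantum operations and may measure at any time; its competitiveness is measured in expectation in the same way. Memory usage counts bits (and qubits) stored while processing any input. *)

(* Defs.v *)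
From mathcomp Require Import all_boot all_order all_algebra.
From mathcomp Require Import spectral complex.
From mathcomp Require Import all_classical all_reals all_analysis.

Set Implicit Arguments.
Unset Strict Implicit.
Unset Printing Implicit Defensive.

Import Order.TTheory GRing.Theory Num.Theory.
Import numFieldNormedType.Exports.

Local Open Scope classical_set_scope.
Local Open Scope ring_scope.

(* [is_input] delimits the legal request sequences and [feasible] the legal
   answers to each of them; both may be taken to be everything.  An
   algorithm produces infeasible answers with probability 0, so the values of
   [cost] there are irrelevant. *)
Record online_problem (R : realType) := OnlineProblem {
  request : Type;
  answer : Type;
  is_input : set (seq request);
  feasible : seq request -> set (seq answer);
  feasible_size : forall I y, is_input I -> feasible I y -> size y = size I;
  cost : seq request -> seq answer -> R;
  cost_gt0 : forall I y, 0 < cost I y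
}.

Definition optimal_offline (R : realType) (S : online_problem R)
    (Opt : seq (request S) -> seq (answer S)) : Prop :=
  forall I, is_input I ->
    feasible I (Opt I) /\ (forall y, feasible I y -> cost I (Opt I) <= cost I y).

(* Both kinds of algorithm are streaming machines.  While [x_i] is the head of
   [todo], the machine performs elementary steps that see only [x_i] and the
   classical memory [mem] (a string of currently stored bits), until a step
   emits [y_i]; then [x_i] is discarded.  The input and output tapes are not
   part of the memory. *)
Definition memory := seq bool.

Record config (X Y : Type) := Config {
  todo : seq X;
  emitted : seq Y;
  mem : memory
}.

Definition start (X Y : Type) (I : seq X) (m : memory) : config X Y :=
  Config I [::] m.

Definition halted (X Y : Type) (c : config X Y) : bool := nilp (todo c).

(* The effect of a step: the new memory and, possibly, the answer to the
   current request. *)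
Definition effect (Y : Type) := (memory * option Y)%type.

Definition advance (X Y : Type) (c : config X Y) (r : effect Y) : config X Y :=
  if r.2 is Some y then Config (behead (todo c)) (rcons (emitted c) y) r.1
  else Config (todo c) (emitted c) r.1.

Variant raction (Y : Type) :=
  | Compute of effect Y
  | ReadBit of (bool -> effect Y).

Record randomized_algorithm (X Y : Type) := RandomizedAlgorithm {
  rinit : memory;
  raction_of : memory -> X -> raction Y
}.

Section Randomized.
Context {X Y : Type} (A : randomized_algorithm X Y).

(* The random tape is read once, from left to right: [kc.1] is the position of
   its head, which is not part of the memory. *)
Definition rstep (psi : nat -> bool) (kc : nat * config X Y) :
    nat * config X Y :=
  let: (k, c) := kc in
  if todo c is x :: _ then
    match raction_of A (mem c) x with
    | Compute r => (k, advance c r)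
    | ReadBit f => (k.+1, advance c (f (psi k)))
    end
  else (k, c).

Definition rconf (I : seq X) (psi : nat -> bool) (t : nat) : config X Y :=
  (iter t (rstep psi) (0%N, start Y I (rinit A))).2.

Definition routput (I : seq X) (psi : nat -> bool) : set (seq Y) :=
  [set y | exists2 t, halted (rconf I psi t) & emitted (rconf I psi t) = y].

End Randomized.

(* [tape k w] is the k-th bit of the random tape. *)
Definition fair_tape (R : realType) (d : measure_display)
    (T : measurableType d) (P : probability T R)
    (tape : nat -> {RV P >-> bool}) : Prop :=
  (forall k b, P (tape k @^-1` [set b]) = (2^-1)%:E) /\
  (forall (J : seq nat) (B : nat -> set bool), uniq J ->
     P (\bigcap_(j in [set` J]) (tape j @^-1` B j)) =
     (\big[*%E/1%E]_(j <- J) P (tape j @^-1` B j))%E).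

Section RandomizedCompetitive.
Context {R : realType} (S : online_problem R) {d : measure_display}
  {T : measurableType d} (P : probability T R) (tape : nat -> {RV P >-> bool})
  (A : randomized_algorithm (request S) (answer S)).

Definition tape_content (w : T) (k : nat) : bool := tape k w.

(* The set below has at most one element; the default value is used only on
   tapes on which the computation does not terminate. *)
Definition rcost (I : seq (request S)) (w : T) : R :=
  xget 0 [set cost I y | y in routput A I (tape_content w)].

Definition randomized_solves : Prop :=
  forall I, is_input I ->
    {ae P, forall w, exists2 y, routput A I (tape_content w) y & feasible I y}.

Definition randomized_competitive
    (Opt : seq (request S) -> seq (answer S)) (c : R) : Prop :=
  exists2 alpha : R, 0 <= alpha &
    forall I, is_input I ->
      ('E_P[rcost I] <= (c * cost I (Opt I) + alpha)%:E)%E.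

(* The number of stored bits is bounded in terms of the length of the input;
   a fixed number of bits is the case of a constant [s]. *)
Definition randomized_uses_bits (s : nat -> nat) : Prop :=
  forall I, is_input I ->
    forall (psi : nat -> bool) (t : nat),
      (size (mem (rconf A I psi t)) <= s (size I))%N.

End RandomizedCompetitive.

(* State of a register of [q] qubits; the basis vector with index [i] is the one
   whose qubit [j] is the [j]-th binary digit of [i]. *)
Definition qstate (R : realType) (q : nat) := 'cV[R[i]]_(2 ^ q).

Definition ones (q : nat) (i : 'I_(2 ^ q)) : {set 'I_q} :=
  [set j : 'I_q | odd (i %/ 2 ^ j)]%SET.

Definition qzero (R : realType) (q : nat) : qstate R q :=
  \col_i ((i == 0%N :> nat)%:R).

(* Measurement of the qubits in [D] in the computational basis, when exactly
   those in [o] are found to be 1.  The result is not normalized: its squared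
   norm carries the probability of the outcome. *)
Definition collapse (R : realType) (q : nat) (D o : {set 'I_q})
    (phi : qstate R q) : qstate R q :=
  \col_i (if (ones i :&: D == o)%SET then phi i 0 else 0).

Definition sqnorm (R : realType) (q : nat) (phi : qstate R q) : R :=
  \sum_i ComplexField.Normc.normc (phi i 0) ^+ 2.

(* A step applies a unitary operator to the register, then measures the qubits
   in [qmeasured] (possibly none); the classical effect depends on the
   outcome. *)
Record qaction (R : realType) (q : nat) (Y : Type) := QAction {
  qunitary : 'M[R[i]]_(2 ^ q);
  qunitaryP : qunitary \is unitarymx;
  qmeasured : {set 'I_q};
  qeffect : {set 'I_q} -> effect Y
}.

Record quantum_algorithm (R : realType) (q : nat) (X Y : Type) :=
  QuantumAlgorithm {
    qinit : memory;
    qaction_of : memory -> X -> qaction R q Y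
  }.

Section Quantum.
Context {R : realType} {q : nat} {X Y : Type} (Q : quantum_algorithm R q X Y).

(* [None] when the machine has already halted. *)
Definition qstep (o : {set 'I_q}) (st : qstate R q * config X Y) :
    option (qstate R q * config X Y) :=
  let: (phi, c) := st in
  if todo c is x :: _ then
    let a := qaction_of Q (mem c) x in
    Some (collapse (qmeasured a) o (qunitary a *m phi), advance c (qeffect a o))
  else None.

Fixpoint qexec (h : seq {set 'I_q}) (st : qstate R q * config X Y) :
    option (qstate R q * config X Y) :=
  if h is o :: h' then obind (qexec h') (qstep o st) else Some st.

(* The computation on [I] along the history [h] of measurement outcomes, one
   for each step. *)
Definition qrun (I : seq X) (h : seq {set 'I_q}) :
    option (qstate R q * config X Y) :=
  qexec h (qzero R q, start Y I (qinit Q)).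

(* The probability that the computation on [I] terminates, with history
   exactly [h] and an output satisfying [F]. *)
Definition qprob (I : seq X) (F : set (seq Y)) (h : seq {set 'I_q}) : R :=
  if qrun I h is Some (phi, c) then
    if halted c && (emitted c \in F) then sqnorm phi else 0
  else 0.

End Quantum.

Section QuantumCompetitive.
Context {R : realType} (S : online_problem R) {q : nat}
  (Q : quantum_algorithm R q (request S) (answer S)).

Definition qcost (I : seq (request S)) (h : seq {set 'I_q}) : R :=
  if qrun Q I h is Some (_, c) then cost I (emitted c) else 0.

Definition expected_qcost (I : seq (request S)) : \bar R :=
  (\esum_(h in [set: seq {set 'I_q}]) (qprob Q I setT h * qcost I h)%:E)%E.

Definition quantum_solves : Prop :=
  forall I, is_input I ->
    (\esum_(h in [set: seq {set 'I_q}]) (qprob Q I (feasible I) h)%:E)%E = 1%E.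

Definition quantum_competitive
    (Opt : seq (request S) -> seq (answer S)) (c : R) : Prop :=
  exists2 alpha : R, 0 <= alpha &
    forall I, is_input I ->
      (expected_qcost I <= (c * cost I (Opt I) + alpha)%:E)%E.

(* Only histories of nonzero probability count. *)
Definition quantum_uses_bits (s : nat -> nat) : Prop :=
  forall I, is_input I ->
    forall (h : seq {set 'I_q}) phi c,
      qrun Q I h = Some (phi, c) -> phi != 0 ->
      (size (mem c) <= s (size I))%N.

End QuantumCompetitive.

(* Main.v *)
(* A coin toss is simulated by applying the square root of NOT to the qubit and
   measuring it: from either basis state both outcomes have probability 1/2, and
   the qubit is left in a basis state, so it can be reused without a reset.
   Hence a history of outcomes has the probability of the cylinder of tapes that
   produce it, and the cylinders of the halting histories partition the tapes on
   which the randomized algorithm halts. *)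

Require Import Defs.
From mathcomp Require Import all_boot all_order all_algebra.
From mathcomp Require Import spectral complex ring.
From mathcomp Require Import all_classical all_reals all_analysis.
From mathcomp Require Import measurable_realfun.

Set Implicit Arguments.
Unset Strict Implicit.
Unset Printing Implicit Defensive.

Import Order.TTheory GRing.Theory Num.Theory.

Local Open Scope classical_set_scope.
Local Open Scope ring_scope.

Lemma unitarymx1 (C : numClosedFieldType) n : (1%:M : 'M[C]_n) \is unitarymx.
Proof. by apply/unitarymxP; rewrite mul1mx trmx1 map_mx1. Qed.

(** * One qubit: the coin toss and its effect on the norm *)

Section Qubit.
Context {R : realType}.
Implicit Types (phi : qstate R 1) (o : {set 'I_1}) (i j : 'I_(2 ^ 1)).

(** Its square swaps the two basis vectors. Entries $(1 \pm i)/2$ have rational coordinates, so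
    unitarity reduces to field identities. *)
Definition sqrt_not : 'M[R[i]]_(2 ^ 1) :=
  \matrix_(i, j) Complex 2^-1 (if i == j then 2^-1 else - 2^-1).

Lemma sqrt_not_unitary : sqrt_not \is unitarymx.
Proof.
apply/unitarymxP/matrixP => -[[|[|//]] ?] [[|[|//]] ?];
  rewrite !mxE big_ord_recl big_ord1 !mxE /=; apply/eqP;
  rewrite eq_complex /=; apply/andP; split; apply/eqP;
  by field.
Qed.

Lemma sqr_normc_sqrt_not i j :
  ComplexField.Normc.normc (sqrt_not i j) ^+ 2 = 2^-1.
Proof.
rewrite mxE /= sqr_sqrtr ?addr_ge0 ?sqr_ge0//.
by case: (i == j); field.
Qed.

(** Invariant of the register along a history: an unnormalized multiple of one basis vector,
    possibly zero. *)
Definition supported_at j phi := forall i, i != j -> phi i 0 = 0.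

Lemma sqnorm_supported j phi : supported_at j phi ->
  sqnorm phi = ComplexField.Normc.normc (phi j 0) ^+ 2.
Proof.
move=> hphi; rewrite /sqnorm (bigD1 j)//= big1 ?addr0// => i /hphi ->.
by rewrite ComplexField.Normc.normc0 expr0n.
Qed.

Lemma sqnorm0 : sqnorm (0 : qstate R 1) = 0.
Proof.
by rewrite /sqnorm big1// => i _; rewrite mxE ComplexField.Normc.normc0 expr0n.
Qed.

Lemma sqnorm_eq0 phi : sqnorm phi = 0 -> phi = 0.
Proof.
move=> /eqP; rewrite psumr_eq0 => [/allP phi0|i _]; last exact: sqr_ge0.
apply/matrixP => i j; rewrite (ord1 j) mxE.
apply: ComplexField.Normc.eq0_normc.
by apply/eqP; rewrite -sqrf_eq0; apply: phi0; rewrite mem_index_enum.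
Qed.

Lemma qzero_supported : supported_at ord0 (qzero R 1).
Proof. by move=> i /negPf; rewrite mxE -val_eqE /= => ->. Qed.

Lemma sqnorm_qzero : sqnorm (qzero R 1) = 1.
Proof.
have q0 : qzero R 1 ord0 0 = 1 by rewrite mxE.
rewrite (sqnorm_supported qzero_supported) q0.
by rewrite ComplexField.Normc.normc1 expr1n.
Qed.

Lemma outcome_eq o o' : (o == o') = ((ord0 \in o) == (ord0 \in o')).
Proof.
apply/idP/idP => [/eqP -> //|/eqP oo']; apply/eqP/setP => k.
by rewrite (ord1 k).
Qed.

Lemma ones_ord0 i : (ord0 \in ones i) = (i != ord0).
Proof. by case: i => -[|[|//]] ?; rewrite inE. Qed.

(** A step without measurement still records an outcome in the history; this leaves it a single
    branch of nonzero weight, the one with the empty outcome. *)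
Lemma collapse_set0 o phi :
  collapse finset.set0 o phi = if ord0 \in o then 0 else phi.
Proof.
apply/matrixP => i j; rewrite (ord1 j) mxE finset.setI0 eq_sym outcome_eq inE.
by case: (ord0 \in o) => //=; rewrite mxE.
Qed.

Lemma collapse0 D o : collapse D o (0 : qstate R 1) = 0.
Proof. by apply/matrixP => i j; rewrite !mxE; case: ifP. Qed.

Definition outcome_index o : 'I_(2 ^ 1) :=
  if ord0 \in o then ord_max else ord0.

Lemma collapse_setT_supported o phi :
  supported_at (outcome_index o) (collapse [set: 'I_1]%SET o phi).
Proof.
move=> i; rewrite /outcome_index mxE finset.setIT outcome_eq ones_ord0.
by case: i => -[|[|//]] ?; case: (ord0 \in o).
Qed.

Lemma collapse_setT_index o phi :
  collapse [set: 'I_1]%SET o phi (outcome_index o) 0 = phi (outcome_index o) 0.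
Proof.
rewrite /outcome_index mxE finset.setIT outcome_eq ones_ord0.
by case: (ord0 \in o).
Qed.

(** Only the entry of [sqrt_not] in column [j] and the measured row contributes, and its squared
    modulus is 1/2; no interference can occur. *)
Lemma sqnorm_coin j o phi : supported_at j phi ->
  sqnorm (collapse [set: 'I_1]%SET o (sqrt_not *m phi)) = 2^-1 * sqnorm phi.
Proof.
move=> hphi; rewrite (sqnorm_supported hphi).
rewrite (sqnorm_supported (@collapse_setT_supported o _)) collapse_setT_index.
rewrite mxE (bigD1 j)//= big1 => [|i /hphi ->]; last by rewrite mulr0.
by rewrite addr0 ComplexField.Normc.normcM exprMn sqr_normc_sqrt_not.
Qed.

End Qubit.

(** * The simulating machine and the histories compatible with a tape *)

Section Simulation.
Context {R : realType} {X Y : Type} (A : randomized_algorithm X Y).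
Implicit Types (psi : nat -> bool) (kc : nat * config X Y) (c : config X Y)
  (h : seq {set 'I_1}) (phi : qstate R 1).

Definition simulation : quantum_algorithm R 1 X Y :=
  QuantumAlgorithm (rinit A) (fun m x =>
    match raction_of A m x with
    | Compute r => QAction (unitarymx1 _ _) finset.set0 (fun=> r)
    | ReadBit f => QAction sqrt_not_unitary [set: 'I_1]%SET (fun o => f (ord0 \in o))
    end).

(* The bit that a simulation driven by the tape [psi] measures; it is 0 for a
   step that reads nothing. *)
Definition outcome psi kc : bool :=
  if todo kc.2 is x :: _ then
    if raction_of A (Defs.mem kc.2) x is ReadBit _ then psi kc.1 else false
  else false.

(** Forbidding steps after halting makes a halting history stop exactly when the machine does. *)
Fixpoint follows psi h kc : bool :=
  if h is o :: h' then
    [&& ~~ halted kc.2, (ord0 \in o) == outcome psi kc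
      & follows psi h' (rstep A psi kc)]
  else true.

Definition after psi h kc : config X Y := (iter (size h) (rstep A psi) kc).2.

Lemma after_cons psi o h kc :
  after psi (o :: h) kc = after psi h (rstep A psi kc).
Proof. by rewrite /after iterSr. Qed.

Lemma rstep_halted psi kc : halted kc.2 -> rstep A psi kc = kc.
Proof. by case: kc => k [[|x l] e m]. Qed.

(** The tape determines each outcome, and neither history can properly extend the other, since the
    shorter one already ends in a halted configuration. *)
Lemma follows_uniq psi h1 h2 kc :
  follows psi h1 kc -> halted (after psi h1 kc) ->
  follows psi h2 kc -> halted (after psi h2 kc) -> h1 = h2.
Proof.
elim: h1 h2 kc => [|o1 h1 IH] [|o2 h2] kc //=.
- by move=> _; rewrite /after /= => -> .
- by move=> + + _ => /and3P[/negPf]; rewrite /after /= => ->.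
case/and3P=> _ /eqP o1E f1 halt1 /and3P[_ /eqP o2E f2] halt2.
rewrite !after_cons in halt1 halt2.
congr (_ :: _); first by apply/eqP; rewrite outcome_eq o1E o2E.
exact: IH f1 halt1 f2 halt2.
Qed.

Lemma follows_exists psi t kc : halted (iter t (rstep A psi) kc).2 ->
  exists2 h, follows psi h kc & after psi h kc = (iter t (rstep A psi) kc).2.
Proof.
elim: t kc => [|t IH] kc; first by exists [::].
rewrite iterSr => /IH[h fh hE].
have [halt|nhalt] := boolP (halted kc.2).
  (* The time [t] may exceed the halting time; the surplus steps change nothing and are dropped from
     the history. *)
  exists [::] => //; rewrite /after /=.
  rewrite rstep_halted//; elim: t {h fh hE IH} => // t IH.
  by rewrite iterSr rstep_halted.
exists ((if outcome psi kc then [set: 'I_1]%SET else finset.set0) :: h).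
  by rewrite /= nhalt fh andbT; case: (outcome psi kc); rewrite inE.
by rewrite after_cons.
Qed.

Lemma qexec0 h c phi' c' :
  qexec simulation h (0, c) = Some (phi', c') -> phi' = 0.
Proof.
elim: h c => [c [] //|o h IH] [[|x l] e m] //=.
by rewrite mulmx0 collapse0; exact: IH.
Qed.

Lemma follows_qexec psi h phi kc : follows psi h kc ->
  exists phi', qexec simulation h (phi, kc.2) = Some (phi', after psi h kc).
Proof.
elim: h phi kc => [|o h IH] phi kc /=; first by exists phi.
case: kc => k [[|x l] e m] //= /andP[/eqP oE].
rewrite after_cons.
rewrite /outcome /= in oE *; case: (raction_of A m x) oE => [r|f] oE /=.
  exact: IH.
by rewrite oE; exact: IH.
Qed.

(** Here [u] lists the bits measured along [h], and [b] tells whether all steps without measurement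
    have the empty outcome. So the compatible tapes form a cylinder, or no tape is compatible and
    the final state is zero. Both [j] and [k] vary in the induction: a coin toss moves the support
    and the tape head. *)
Lemma qexec_follows h phi j k c phi' c' : supported_at j phi ->
  qexec simulation h (phi, c) = Some (phi', c') ->
  exists (b : bool) (u : seq bool),
    sqnorm phi' = b%:R * 2^-1 ^+ size u * sqnorm phi /\
    forall psi, follows psi h (k, c) =
                b && (u == [seq psi i | i <- iota k (size u)]).
Proof.
elim: h phi j k c => [|o h IH] phi j k c phij /=.
  by case=> <- _; exists true, [::]; split=> //=; rewrite !mul1r.
case: c => -[|x l] e m //=; rewrite /outcome /=.
case: (raction_of A m x) => [r|f] /=.
  rewrite mul1mx collapse_set0; case: ifP => oE.
    by move=> /qexec0 ->; exists false, [::]; rewrite sqnorm0 !mul0r.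
  by move=> /(IH _ _ k _ phij) [b [u [? uE]]]; exists b, u.
move=> /(IH _ _ k.+1 _ (@collapse_setT_supported _ _ _)) [b [u [sq uE]]].
exists b, ((ord0 \in o) :: u); split.
  by rewrite sq (sqnorm_coin o phij) exprS; ring.
move=> psi /=; rewrite eqseq_cons andbCA.
by have [oE|] := eqVneq (ord0 \in o) (psi k); rewrite /= ?andbF// -oE uE.
Qed.

End Simulation.

(** * Sums over countable types and integrals over countable partitions *)

Section CountableSums.
Local Open Scope ereal_scope.
Context {R : realType}.

(** Gives the sum the form of a series over [nat], to which monotone convergence applies; numbers
    that encode nothing contribute 0. *)
Lemma esum_pickle_inv (K : countType) (g : K -> \bar R) : (forall k, 0 <= g k) ->
  \esum_(k in [set: K]) g k = \sum_(n <oo) oapp g 0 (pickle_inv n).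
Proof.
move=> g0; rewrite nneseries_esumT; last by move=> n; case: pickle_inv.
have -> : \esum_(k in [set: K]) g k =
    \esum_(k in [set: K]) oapp g 0 (pickle_inv (pickle k)).
  by apply: eq_esum => k _; rewrite pickleK_inv.
rewrite -(@esum_image _ _ _ setT pickle (fun n => oapp g 0 (pickle_inv n))).
  rewrite esum_mkcond; apply: eq_esum => n _.
  case: ifPn => //; rewrite notin_setE /= => nK.
  have := @pickle_invK K n; case: pickle_inv => [k|] //= kn.
  by exfalso; apply: nK; exists k.
by move=> x y _ _; exact: (pcan_inj (@pickleK_inv K)).
Qed.

Lemma esum_single (K : choiceType) (g : K -> \bar R) (k : K) : 0 <= g k ->
  (forall k', k' != k -> g k' = 0) -> \esum_(i in [set: K]) g i = g k.
Proof.
move=> g0 gk; rewrite -(@esum_set1 _ _ k g)// [RHS]esum_mkcond.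
apply: eq_esum => i _; case: ifPn => //; rewrite notin_setE /= => /eqP.
exact: gk.
Qed.

Lemma integral_countable_partition d (T : measurableType d)
    (mu : {measure set T -> \bar R}) (K : countType) (E : K -> set T)
    (a : K -> R) (f : T -> R) :
  (forall k, measurable (E k)) -> trivIset setT E ->
  (forall k, (0 <= a k)%R) ->
  (forall k w, E k w -> f w = a k) ->
  (forall w, (forall k, ~ E k w) -> f w = 0%R) ->
  \int[mu]_w (f w)%:E = \esum_(k in [set: K]) ((a k)%:E * mu (E k)).
Proof.
move=> mE tE a0 fE f0.
have ind0 k w : (0 <= (a k * \1_(E k) w)%R%:E) by rewrite lee_fin mulr_ge0.
have -> : \int[mu]_w (f w)%:E =
    \int[mu]_w (\sum_(n <oo) oapp (fun k => (a k * \1_(E k) w)%:E) 0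
       (@pickle_inv K n)).
  (* Pointwise, disjointness leaves at most one nonzero term in the series. *)
  apply: eq_integral => w _; rewrite -esum_pickle_inv//.
  have [[k Ek]|nE] := pselect (exists k, E k w).
    rewrite (esum_single (k := k))// => [|k' kk'].
      by rewrite (fE _ _ Ek) indicE mem_set// mulr1.
    rewrite indicE memNset ?mulr0// => Ek'; move/eqP: kk'; apply.
    by apply: tE => //; exists w.
  rewrite f0 => [|k Ek]; last by apply: nE; exists k.
  rewrite esum1// => k _; rewrite indicE memNset ?mulr0// => Ek.
  by apply: nE; exists k.
rewrite integral_nneseries//.
- rewrite esum_pickle_inv => [|k]; last by rewrite mule_ge0// lee_fin.
  apply: eq_eseriesr => n _; case: pickle_inv => [k|] /=; last exact: integral0.
  under eq_integral do rewrite EFinM.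
  rewrite ge0_integralZl_EFin//; first by rewrite integral_indic// setIT.
  by apply/measurable_EFinP; exact: measurable_indic.
- move=> n; case: pickle_inv => [k|] //=.
  by apply/measurable_EFinP; apply: measurable_funM => //; exact: measurable_indic.
- by move=> n w _; case: pickle_inv => [k|] //=; exact: ind0.
Qed.

End CountableSums.

(** * Cylinders of the fair tape and the probabilities of histories *)

Section FairTape.
Context {R : realType} d (T : measurableType d) (P : probability T R)
  (tape : nat -> {RV P >-> bool}) (htape : fair_tape tape).

Lemma fair_tape_prefix k (u : seq bool) :
  let B := [set w | u == [seq tape_content tape w i | i <- iota k (size u)]] in
  measurable B /\ P B = (2^-1 ^+ size u)%:E.
Proof.
(* The cylinder is a finite intersection of independent events of probability 1/2; position [i] of
   the tape carries entry [i - k] of [u]. *)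
pose b i : set bool := [set nth false u (i - k)].
have -> : [set w | u == [seq tape_content tape w i | i <- iota k (size u)]] =
    \bigcap_(i in [set` iota k (size u)]) (tape i @^-1` b i).
  apply/seteqP; split=> w /=.
    move=> /eqP uE i /=; rewrite mem_iota => /andP[ki ik].
    rewrite /b /= [u in RHS]uE (nth_map 0%N) ?size_iota ?ltn_subLR//.
    by rewrite nth_iota ?ltn_subLR// subnKC.
  move=> uE; apply/eqP/(@eq_from_nth _ false) => [|i iu].
    by rewrite size_map size_iota.
  rewrite (nth_map 0%N) ?size_iota// nth_iota//.
  rewrite /tape_content uE /= ?addKn//.
  by rewrite mem_iota leq_addr ltn_add2l.
split.
  apply: fin_bigcap_measurable => // i _; exact: measurable_funPTI.
rewrite (htape.2 _ _ (iota_uniq _ _)).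
under eq_bigr do rewrite htape.1.
elim: u k {b} => [|x u IH] k; first by rewrite big_nil.
by rewrite /= big_cons IH exprS EFinM.
Qed.

Section Events.
Context {X Y : Type} (A : randomized_algorithm X Y) (I : seq X).
Implicit Types (F : set (seq Y)) (h : seq {set 'I_1}) (psi : nat -> bool).
Let st := (0%N, start Y I (rinit A)).

Definition ends_with psi F h : Prop :=
  [/\ follows A psi h st, halted (after A psi h st)
    & F (emitted (after A psi h st))].

Lemma routputE psi F :
  (exists2 y, routput A I psi y & F y) <-> exists h, ends_with psi F h.
Proof.
split=> [[_ [t halt <-]] Fy|[h [_ halt Fy]]].
  by have [h fh hE] := follows_exists halt; exists h; split; rewrite ?hE.
by exists (emitted (after A psi h st)) => //; exists (size h).
Qed.

Lemma ends_with_uniq psi F h1 h2 :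
  ends_with psi F h1 -> ends_with psi F h2 -> h1 = h2.
Proof. by move=> [f1 halt1 _] [f2 halt2 _]; exact: follows_uniq f1 _ f2 _. Qed.

Lemma routput_ends_with psi F h y : ends_with psi F h ->
  routput A I psi y -> y = emitted (after A psi h st).
Proof.
move=> [fh halth _] [t halt <-]; have [h' fh' hE] := follows_exists halt.
have halth' : halted (after A psi h' st) by rewrite hE.
by rewrite (follows_uniq fh halth fh' halth') hE.
Qed.

Definition event F h : set T := [set w | ends_with (tape_content tape w) F h].

(** The history alone fixes the final configuration, so halting and [F] do not depend on the tape.
    What remains is the cylinder of [u], whose probability is the squared norm of the final state,
    or the empty set. *)
Lemma eventP F h :
  measurable (event F h) /\ P (event F h) = (qprob (simulation A) I F h)%:E.
Proof.
rewrite /qprob; case E: qrun => [[phi c]|]; last first.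
  have -> : event F h = set0; last by rewrite measure0.
  rewrite -subset0 => w [/(follows_qexec (qzero R 1)) [phi']].
  by rewrite -[qexec _ _ _]/(qrun _ I h) E.
have afterE psi : follows A psi h st -> after A psi h st = c.
  move=> /(follows_qexec (qzero R 1)) [phi'].
  by rewrite -[qexec _ _ _]/(qrun _ I h) E => -[].
have [/andP[halt /set_mem Fc]|nhalt] := ifPn; last first.
  have -> : event F h = set0; last by rewrite measure0.
  rewrite -subset0 => w [/afterE -> halt Fc].
  by rewrite halt mem_set in nhalt.
have [b [u [sq uE]]] := qexec_follows 0 qzero_supported E.
have -> : event F h = if b then
    [set w | u == [seq tape_content tape w i | i <- iota 0 (size u)]] else set0.
  apply/seteqP; split=> w; rewrite /event /ends_with /= uE.
    by case: b {sq uE} => -[].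
  case: b {sq} uE => //= uE uw.
  by rewrite uw afterE ?uE.
rewrite sq sqnorm_qzero mulr1; case: b {sq uE}; last first.
  by rewrite mul0r measure0.
by rewrite mul1r; exact: fair_tape_prefix.
Qed.

Lemma trivIset_event F : trivIset setT (event F).
Proof. by move=> h1 h2 _ _ [w [/ends_with_uniq + +]]; apply. Qed.

End Events.
End FairTape.

(** * Correctness, competitiveness and memory of the simulation *)

Theorem theorem8 (R : realType) (S : online_problem R)
    (Opt : seq (request S) -> seq (answer S)) (hOpt : optimal_offline Opt)
    (d : measure_display) (T : measurableType d) (P : probability T R)
    (tape : nat -> {RV P >-> bool}) (htape : fair_tape tape)
    (c : R) (s : nat -> nat)
    (A : randomized_algorithm (request S) (answer S))
    (hsolves : randomized_solves tape A)
    (hcomp : randomized_competitive tape A Opt c)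
    (hmem : randomized_uses_bits A s) :
  exists Q : quantum_algorithm R 1 (request S) (answer S),
    [/\ quantum_solves Q,
        quantum_competitive Q Opt c &
        quantum_uses_bits Q s].
Proof.
exists (simulation A); split.
- move=> I inI; pose E := event tape A I (feasible I).
  have mE h : measurable (E h) by case: (eventP htape A I (feasible I) h).
  have mU : measurable (\bigcup_h E h).
    by apply: countable_bigcupT_measurable => //; exact: countableP.
  (* With weight 1 on every history, the sum becomes the integral of the indicator of the union of
     the events. *)
  rewrite -(eq_esum (a := fun h => (1%:E * P (E h))%E)); last first.
    by move=> h _; rewrite mul1e (eventP htape A I (feasible I) h).2.
  rewrite -(@integral_countable_partition _ _ _ _ _ E (fun=> 1)
    (\1_(\bigcup_h E h)))//; first last.
  - by move=> w nE; rewrite indicE memNset// => -[h _ /nE].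
  - by move=> h w Eh; rewrite indicE mem_set//; exists h.
  - exact: trivIset_event.
  rewrite integral_indic// setIT.
  (* Off the union no feasible output is produced, which [hsolves] confines to a negligible set. *)
  have PU0 : P (~` \bigcup_h E h) = 0%E.
    apply/(negligibleP _ (measurableC mU)).
    apply: (negligibleS _ (hsolves I inI)) => w /= nE /routputE[h Eh].
    by apply: nE; exists h.
  have := probability_setC P (measurableC mU).
  by rewrite setCK PU0 sube0.
- case: hcomp => alpha alpha0 hA; exists alpha => // I /hA; apply: le_trans.
  pose E := event tape A I setT.
  have mE h : measurable (E h) by case: (eventP htape A I setT h).
  (* The cost is constant on each event, so [rcost] is a countable step function. *)
  have qcostE h w : E h w -> qcost (simulation A) I h =
      cost I (emitted (after A (tape_content tape w) h
        (0%N, start _ I (rinit A)))).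
    move=> [fh _ _]; rewrite /qcost.
    by have [phi] := follows_qexec (qzero R 1) fh; rewrite /qrun => ->.
  have -> : expected_qcost (simulation A) I =
      (\esum_(h in [set: seq {set 'I_1}])
        ((qcost (simulation A) I h)%:E * P (E h)))%E.
    apply: eq_esum => h _.
    by rewrite (eventP htape A I setT h).2 -EFinM mulrC.
  rewrite unlock (@integral_countable_partition _ _ _ _ _ E
    (qcost (simulation A) I))//.
  - exact: trivIset_event.
  - by move=> h; rewrite /qcost; case: qrun => [[phi e]|]//; exact/ltW/cost_gt0.
  - move=> h w Eh; rewrite (qcostE _ _ Eh); apply: xget_unique.
      have [y ry _] := (routputE A I _ setT).2 (ex_intro _ h Eh).
      by exists y => //; rewrite (routput_ends_with Eh ry).
    by move=> _ [y ry <-]; rewrite (routput_ends_with Eh ry).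
  (* Outside all events the computation does not terminate, and [rcost] takes its default value
     0. *)
  - move=> w nE; apply: xgetPN => _ [y ry _].
    have [h Eh] := (routputE A I (tape_content tape w) setT).1
      (ex_intro2 _ _ y ry Logic.I).
    exact: nE Eh.
- move=> I inI h phi c' hE phi0.
  have [b [u [sq uE]]] := qexec_follows 0 (@qzero_supported R) hE.
  (* The memory bound holds for every single tape, so one tape following [h] suffices: [u] padded
     with [false]. The flag [b] is true because a nonzero state has nonzero norm. *)
  have fh : follows A (fun i => nth false u i) h (0%N, start _ I (rinit A)).
    rewrite uE map_nth_iota0// take_size eqxx andbT.
    case: b sq {uE} => //; rewrite !mul0r => /sqnorm_eq0 phi_eq0.
    by rewrite phi_eq0 eqxx in phi0.
  have [phi'] := follows_qexec (qzero R 1) fh.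
  by rewrite -[qexec _ _ _]/(qrun _ I h) hE => -[_ ->]; exact: hmem.
Qed.
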